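(* Let $N\ge 1$, $p>2$, and let $w\in C^1(\mathbb{R}^N)$ be a positive function with $w(x)>C$ for all $x\in\mathbb{R}^N$, for some constant $C>0$. For $R>0$ set $$A_R=\|w\|^{\frac{p+3}{p-1}}_{L^{\frac{p+3}{p-1}}(B_{2R}(0))}=\int_{B_{2R}(0)} w(x)^{\frac{p+3}{p-1}}\,dx .$$ Suppose $A_R=\mathcal{O}(R^\mu)$ (as $R\to\infty$) for some $\mu<\frac{p(p+3)}{p-1}$. Then for every $0<\zeta<1$ there is no stable weak solution $u\in C^{1,\zeta}_{loc}(\mathbb{R}^N)$ of $$-\operatorname{div}\big(w(x)|\nabla u|^{p-2}\nabla u\big)=e^u\quad\text{in }\mathbb{R}^N.$$
   Context: A function $u\in C^{1,\zeta}_{loc}(\mathbb{R}^N)$ is a weak solution of $-\operatorname{div}(w|\nabla u|^{p-2}\nabla u)=f(u)$ in $\mathbb{R}^N$ if $\int_{\mathbb{R}^N} w|\nabla u|^{p-2}\nabla u\cdot\nabla\varphi\,dx-\int_{\mathbb{R}^N} f(u)\varphi\,dx=0$ for all $\varphi\in C^1_c(\mathbb{R}^N)$. Such a weak solution is stable if for all $\varphi\in C^1_c(\mathbb{R}^N)$, $$\int_{\mathbb{R}^N} w|\nabla u|^{p-2}|\nabla\varphi|^2dx+(p-2)\int_{\mathbb{R}^N} w|\nabla u|^{p-4}(\nabla u\cdot\nabla\varphi)^2dx-\int_{\mathbb{R}^N} f'(u)\varphi^2dx\ge 0.$$ Here $f(u)=e^u$, so $f'(u)=e^u$. $B_r(0)$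 denotes the open ball of radius $r$ centered at the origin. *)

(* Defs.v *)
From HB Require Import structures.
From mathcomp Require Import all_boot all_order all_algebra.
From mathcomp Require Import all_classical all_reals all_analysis.
Set Implicit Arguments. Unset Strict Implicit. Unset Printing Implicit Defensive.
Import Order.TTheory GRing.Theory Num.Theory.
Import numFieldNormedType.Exports.
Local Open Scope classical_set_scope.
Local Open Scope ring_scope.

Section Defs.
Variable R : realType.

(* Euclidean inner product and Euclidean norm on R^N
   (the library norm on matrices is the sup norm, so we do not use it). *)
Definition dotv (N : nat) (a b : 'rV[R]_N) : R := \sum_(i < N) a 0 i * b 0 i.
Definition enorm (N : nat) (a : 'rV[R]_N) : R := Num.sqrt (dotv a a).

Definition ball0 (N : nat) (r : R) : set 'rV[R]_N := [set x | enorm x < r].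

Definition evec (N : nat) (i : 'I_N) : 'rV[R]_N := delta_mx 0 i.

Definition grad (N : nat) (f : 'rV[R]_N -> R) (x : 'rV[R]_N) : 'rV[R]_N :=
  \row_i ('D_(evec i) f x).

Definition C1 (N : nat) (f : 'rV[R]_N -> R) : Prop :=
  forall i : 'I_N, (forall x, derivable f x (evec i)) /\
                   continuous (fun x => 'D_(evec i) f x).

(* C^{1,zeta}_loc(R^N): C^1 and the gradient is zeta-Hoelder continuous on
   every ball B_r(0) (equivalently, on every compact set). *)
Definition C1zeta_loc (N : nat) (zeta : R) (f : 'rV[R]_N -> R) : Prop :=
  C1 f /\
  forall r : R, 0 < r -> exists L : R, forall x y, ball0 r x -> ball0 r y ->
    enorm (grad f x - grad f y) <= L * (enorm (x - y)) `^ zeta.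

Definition C1c (N : nat) (f : 'rV[R]_N -> R) : Prop :=
  C1 f /\ exists r : R, forall x, r <= enorm x -> f x = 0.

(* Integral over R^N w.r.t. N-dimensional Lebesgue measure, realized as an
   iterated one-dimensional Lebesgue integral (first coordinate outermost). *)
Fixpoint intRN (n : nat) : ('rV[R]_n -> \bar R) -> \bar R :=
  match n return ('rV[R]_n -> \bar R) -> \bar R with
  | 0 => fun f => f 0
  | n'.+1 => fun f =>
      (\int[@lebesgue_measure R]_t
          intRN (fun y : 'rV[R]_n' => f (row_mx (\row_(_ < 1) t) y)))%E
  end.

Definition weak_solution (N : nat) (w : 'rV[R]_N -> R) (p : R)
    (u : 'rV[R]_N -> R) : Prop :=
  forall phi : 'rV[R]_N -> R, C1c phi ->
    (intRN (fun x => (w x * (enorm (grad u x)) `^ (p - 2)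
                      * dotv (grad u x) (grad phi x))%:E)
     - intRN (fun x => (expR (u x) * phi x)%:E) = 0)%E.

(* Stability (here f(u) = e^u, f'(u) = e^u). *)
Definition stable (N : nat) (w : 'rV[R]_N -> R) (p : R)
    (u : 'rV[R]_N -> R) : Prop :=
  forall phi : 'rV[R]_N -> R, C1c phi ->
    (0 <= intRN (fun x => (w x * (enorm (grad u x)) `^ (p - 2)
                           * (enorm (grad phi x)) ^+ 2)%:E)
          + (p - 2)%:E
            * intRN (fun x => (w x * (enorm (grad u x)) `^ (p - 4)
                               * (dotv (grad u x) (grad phi x)) ^+ 2)%:E)
          - intRN (fun x => (expR (u x) * phi x ^+ 2)%:E))%E.

Definition A_R (N : nat) (w : 'rV[R]_N -> R) (p : R) (r : R) : \bar R :=
  intRN (fun x => (\1_(ball0 (2 * r)) x * (w x) `^ ((p + 3) / (p - 1)))%:E).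

End Defs.

(* Main.v *)
Require Import Defs.
From HB Require Import structures.
From mathcomp Require Import all_boot all_order all_algebra.
From mathcomp Require Import all_classical all_reals all_analysis.
From mathcomp Require Import ring lra zify.
Set Implicit Arguments.
Unset Strict Implicit.
Unset Printing Implicit Defensive.
Import Order.TTheory GRing.Theory Num.Theory.
Import numFieldNormedType.Exports.
Local Open Scope classical_set_scope.
Local Open Scope ring_scope.

(** Write [q = 2 * al + 1].  Test the weak equation with [e^(2 al u) h^(2k)]
    and the stability inequality with [e^(al u) h^k], where [h] is the positive
    part of [1 - |x|^2 / (4 r^2)].  For [(p - 1) al < 2] the terms in
    [w |grad u|^p] cancel with a favourable sign, and the remaining terms are
    absorbed pointwise (Young's inequality), which leaves
    [int e^(q u) h^(2k) <= K r^(- p q) int_(B_2r) w^q].  Since [w > C], the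
    integral of [w^q] is controlled by [A_R = O(r^mu)] as soon as
    [q <= (p + 3) / (p - 1)]; taking [al] close to [2 / (p - 1)] makes
    [p q > mu], so the right-hand side tends to [0] while the left-hand side is
    positive and nondecreasing in [r]. *)

(** * Iterated integrals of compactly supported continuous functions *)

Section IteratedIntegral.
Variable R : realType.
Local Notation mu := (@lebesgue_measure R).

(** Subtracting [theta] times the equation from [p - 1] times the first stability integrand gives
    [|grad u|^2] the coefficient [al * ((p - 1) * al - 2 * theta)], while the surviving multiple of
    the mass is [1 - theta] up to a small [delta]. Both signs are right for some [theta] exactly
    when [(p - 1) * al < 2]. In the limit [al = 2 / (p - 1)] one gets [q = (p + 3) / (p - 1)], and
    [p * q] becomes the critical growth exponent.

    The exponent of the cutoff is taken large because the two absorptions cost a factor [h^(- p q)],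
    which [h^(2k)] has to pay for.

    Two obstacles shape the rest. The integral is iterated, so linearity is established only for
    continuous compactly supported integrands, while the integrand of [A_R] contains an indicator.
    Hence the whole estimate is carried out pointwise on one continuous density, and [A_R] enters
    once, through monotonicity of integrals of nonnegative functions. Moreover [C1] speaks of
    partial derivatives only, so continuity and the chain rule are obtained along coordinate
    lines. *)

Definition box_supp (n : nat) (r : R) (f : 'rV[R]_n -> R) : Prop :=
  forall (x : 'rV[R]_n) (i : 'I_n), r <= `|x 0 i| -> f x = 0.

(** Support is measured coordinatewise so that slices inherit the same radius. In dimension 0 the
    support condition is vacuous, which suits the base case of the inductions. *)
Definition Cc (n : nat) (f : 'rV[R]_n -> R) : Prop :=
  continuous f /\ exists r, box_supp r f.

Definition RintN (n : nat) (f : 'rV[R]_n -> R) : R := fine (intRN (EFin \o f)).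

Definition rcons_row (n : nat) (t : R) (y : 'rV[R]_n) : 'rV[R]_n.+1 :=
  row_mx (\row_(_ < 1) t) y.

Lemma rcons_row0 n t (y : 'rV[R]_n) : rcons_row t y 0 0 = t.
Proof. by rewrite /rcons_row mxE; case: splitP => // j _; rewrite mxE. Qed.

Lemma rcons_rowS n t (y : 'rV[R]_n) j : rcons_row t y 0 (lift 0 j) = y 0 j.
Proof.
rewrite /rcons_row mxE; case: splitP => [k /=|k [jk]]; first by rewrite ord1.
by congr (y 0 _); exact/val_inj.
Qed.

Lemma rcons_row_split n (P : R -> Prop) t (y : 'rV[R]_n) :
  P t -> (forall j, P (y 0 j)) -> forall i, P (rcons_row t y 0 i).
Proof.
move=> Pt Py i; case: (unliftP 0 i) => [j ->|->]; first by rewrite rcons_rowS.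
by rewrite rcons_row0.
Qed.

Lemma intRNS n (f : 'rV[R]_n.+1 -> \bar R) :
  intRN f = (\int[mu]_t intRN (fun y => f (rcons_row t y)))%E.
Proof. by []. Qed.

Lemma intRN_ge0 n (f : 'rV[R]_n -> \bar R) :
  (forall x, 0 <= f x)%E -> (0 <= intRN f)%E.
Proof.
elim: n f => [|n IH] f f0; first exact: f0.
by apply: integral_ge0 => t _; exact: IH.
Qed.

(* Integrals of nonnegative functions are suprema over simple functions, so
   monotonicity holds without any measurability assumption. *)
Lemma ge0_le_intRN n (f g : 'rV[R]_n -> \bar R) :
  (forall x, 0 <= f x)%E -> (forall x, f x <= g x)%E ->
  (intRN f <= intRN g)%E.
Proof.
elim: n f g => [|n IH] f g f0 fg; first exact: fg.
rewrite !intRNS.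
have fgt t : (intRN (fun y => f (rcons_row t y))
              <= intRN (fun y => g (rcons_row t y)))%E.
  exact: IH.
have ft t : (0 <= intRN (fun y => f (rcons_row t y)))%E by exact: intRN_ge0.
rewrite !ge0_integralTE//; last by move=> t; exact: le_trans (ft t) (fgt t).
apply: le_ereal_sup => _ [h /= hf <-]; exists h => // t.
exact: le_trans (hf t) (fgt t).
Qed.

Lemma rcons_row_continuous n :
  continuous (fun ty : R * 'rV[R]_n => rcons_row ty.1 ty.2).
Proof.
move=> [t y] A /nbhs_ballP[e /= e0 eA].
exists (ball t e, ball y e) => /=; first by split; exact: nbhsx_ballx.
move=> [s z] /= [ts [_ yz]]; apply: eA; split => // i j; rewrite !ord1.
case: (unliftP 0 j) => [k ->|->]; first by rewrite !rcons_rowS; exact: yz.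
by rewrite !rcons_row0.
Qed.

Lemma rcons_row_continuousr n t : continuous (@rcons_row n t).
Proof.
move=> y A /(@rcons_row_continuous n (t, y) A)[[U V] [/= tU yV] UVA].
apply: filterS yV => z Vz; apply: (UVA (t, z)); split => //=.
exact: nbhs_singleton.
Qed.

Lemma box_suppS n r t (f : 'rV[R]_n.+1 -> R) :
  box_supp r f -> box_supp r (f \o rcons_row t).
Proof. by move=> fr x i rx /=; apply: (fr _ (lift 0 i)); rewrite rcons_rowS. Qed.

Lemma box_supp_head n r t (f : 'rV[R]_n.+1 -> R) :
  box_supp r f -> r <= `|t| -> f \o rcons_row t = cst 0.
Proof.
by move=> fr rt; apply/funext => y /=; apply: (fr _ 0); rewrite rcons_row0.
Qed.

Lemma Cc_rcons n t (f : 'rV[R]_n.+1 -> R) : Cc f -> Cc (f \o rcons_row t).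
Proof.
move=> [cf [r fr]]; split; last by exists r; exact: box_suppS.
by move=> y; apply: continuous_comp; [exact: rcons_row_continuousr|exact: cf].
Qed.

Lemma CcD n (f g : 'rV[R]_n -> R) : Cc f -> Cc g -> Cc (f \+ g).
Proof.
move=> [cf [r fr]] [cg [s gs]]; split.
  by move=> x; apply: continuousD; [exact: cf|exact: cg].
exists (Num.max r s) => x i; rewrite ge_max => /andP[rx sx] /=.
by rewrite (fr _ i)// (gs _ i)// addr0.
Qed.

Lemma CcM n (f g : 'rV[R]_n -> R) : continuous f -> Cc g -> Cc (f \* g).
Proof.
move=> cf [cg [r gr]]; split.
  by move=> x; apply: continuousM; [exact: cf|exact: cg].
by exists r => x i rx /=; rewrite (gr _ i)// mulr0.
Qed.

Lemma CcZ n k (f : 'rV[R]_n -> R) : Cc f -> Cc (k \*o f).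
Proof.
move=> Cf; apply: CcM Cf; exact: cst_continuous.
Qed.

Lemma Cc0 n : Cc (cst 0 : 'rV[R]_n -> R).
Proof. by split; [exact: cst_continuous|exists 0]. Qed.

Lemma Cc1_integrable (f : R -> R) r : continuous f ->
  (forall t, r <= `|t| -> f t = 0) -> mu.-integrable setT (EFin \o f).
Proof.
move=> cf fr.
have : mu.-integrable `[- r, r] (EFin \o f).
  apply: continuous_compact_integrable; first exact: segment_compact.
  exact: continuous_subspaceT.
rewrite [X in X -> _]integrable_mkcond//; congr (_.-integrable _ _).
apply/funext => t; rewrite patchE; case: ifPn => // tr /=.
rewrite fr//; rewrite leNgt; apply: contra tr => tr; rewrite inE/= in_itv/=.
by rewrite -ler_norml ltW.
Qed.

(** Uniformity in [y] is a tube-lemma argument on the compact box [K]; outside [K] both slices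
    vanish. *)
Lemma Cc_tube n (f : 'rV[R]_n.+1 -> R) (t e : R) : Cc f -> 0 < e ->
  \forall s \near t, forall y,
    `|(f \o rcons_row s) y - (f \o rcons_row t) y| < e.
Proof.
move=> [cf [r fr]] e0.
pose K : set 'rV[R]_n := [set v | forall i, `[- r, r]%classic (v ord0 i)].
have cK : compact K.
  by apply: (@rV_compact _ _ (fun=> `[- r, r]%classic)) => _; exact: segment_compact.
have near_K := (compact_near_coveringP K).1 cK R (nbhs t)
  (fun s y => `|f (rcons_row s y) - f (rcons_row t y)| < e) (nbhs_filter t).
apply: filterS (near_K _) => [s Ks y|y _]; last first.
  have e2 : 0 < e / 2 by rewrite divr_gt0.
  have := @rcons_row_continuous n (t, y) _ (cf (rcons_row t y) _ (nbhsx_ballx (f (rcons_row t y)) _ e2)).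
  move=> [[U V] [/= tU yV] UVA].
  exists (V, U) => //= -[z s] [/= Vz Us].
  have Ut : U t by exact: nbhs_singleton.
  have := UVA (s, z) (conj Us Vz); have := UVA (t, z) (conj Ut Vz).
  rewrite /ball/= !ltr_norml => /andP[A1 A2] /andP[A3 A4].
  by apply/andP; split; lra.
have [Ky|] := pselect (K y); first exact: Ks.
move=> /existsNP[i]; rewrite /= in_itv/= -ler_norml => /negP; rewrite -ltNge => ri.
rewrite /= !(fr _ (lift 0 i)) ?subrr ?normr0//; by rewrite rcons_rowS ltW.
Qed.

(* The bound and linearity in dimension [n] give the continuity of slice integrals,
   hence integrability in dimension [n + 1]; so all are proved together. *)
Record integral_spec (n : nat) : Prop := IntegralSpec {
  Cc_fin : forall f : 'rV[R]_n -> R, Cc f -> intRN (EFin \o f) \is a fin_num;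
  RintN_D : forall f g : 'rV[R]_n -> R, Cc f -> Cc g -> RintN (f \+ g) = RintN f + RintN g;
  RintN_Z : forall k (f : 'rV[R]_n -> R), Cc f -> RintN (k \*o f) = k * RintN f;
  RintN_le : forall f g : 'rV[R]_n -> R, Cc f -> Cc g -> (forall x, f x <= g x) ->
    RintN f <= RintN g;
  RintN_bound : forall r : R, 0 <= r -> exists2 V : R, 0 <= V &
    forall (M : R) (f : 'rV[R]_n -> R), Cc f -> box_supp r f ->
      0 <= M -> (forall x, `|f x| <= M) -> `|RintN f| <= M * V }.

Section Slices.
Variable n : nat.
Hypothesis Sn : integral_spec n.

Let RintN_B (f g : 'rV[R]_n -> R) : Cc f -> Cc g -> RintN (f \- g) = RintN f - RintN g.
Proof.
move=> cf cg; rewrite -mulN1r -(RintN_Z Sn)// -(RintN_D Sn)//; last exact: CcZ.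
by congr RintN; apply/funext => x /=; rewrite mulN1r.
Qed.

Lemma slice_continuous (f : 'rV[R]_n.+1 -> R) : Cc f ->
  continuous (fun t => RintN (f \o rcons_row t)).
Proof.
move=> Cf t; have [cf [r fr]] := Cf.
(* The support radius [r] may be negative, so the bound is taken for the box of radius [|r|]. *)
have [V V0 VP] := RintN_bound Sn (normr_ge0 r).
apply/cvgrPdist_le => e e0.
(* [V + 1] replaces [V] because [V] may be zero. *)
have eV : 0 < e / (V + 1) by rewrite divr_gt0// ltr_wpDl.
near=> s.
rewrite -RintN_B; [|exact: Cc_rcons|exact: Cc_rcons].
apply: le_trans (_ : e / (V + 1) * V <= _); last first.
  by rewrite mulrAC ler_pdivrMr ?ltr_wpDl// ler_pM2l// lerDl.
apply: VP.
- rewrite (_ : _ \- _ = (f \o rcons_row t) \+ (-1 \*o (f \o rcons_row s))).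
    by apply: CcD; [exact: Cc_rcons|apply: CcZ; exact: Cc_rcons].
  by apply/funext => y /=; rewrite mulN1r.
- move=> y i ry /=.
  have ry' : r <= `|y 0 i| by exact: le_trans (ler_norm _) ry.
  by rewrite !(fr _ (lift 0 i)) ?subrr// rcons_rowS.
- exact: ltW.
- move=> y; apply: ltW; rewrite distrC; move: y.
  by near: s; exact: Cc_tube.
Unshelve. all: by end_near. Qed.

Lemma slice_supp (f : 'rV[R]_n.+1 -> R) r t : box_supp r f -> r <= `|t| ->
  RintN (f \o rcons_row t) = 0.
Proof.
move=> fr rt; rewrite (box_supp_head fr rt) -[RHS](mul0r (RintN (cst 0 : 'rV[R]_n -> R))).
rewrite -(RintN_Z Sn)//; last exact: Cc0.
by congr RintN; apply/funext => x /=; rewrite mul0r.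
Qed.

Lemma slice_integrable (f : 'rV[R]_n.+1 -> R) : Cc f ->
  mu.-integrable setT (EFin \o (fun t => RintN (f \o rcons_row t))).
Proof.
move=> Cf; have [_ [r fr]] := Cf; apply: (@Cc1_integrable _ r).
  exact: slice_continuous.
by move=> t; exact: slice_supp.
Qed.

Lemma intRNS_slice (f : 'rV[R]_n.+1 -> R) : Cc f ->
  intRN (EFin \o f) = (\int[mu]_t (RintN (f \o rcons_row t))%:E)%E.
Proof.
move=> Cf; rewrite intRNS; apply: eq_integral => t _.
by rewrite /RintN fineK//; apply: (Cc_fin Sn); exact: Cc_rcons.
Qed.

Lemma RintN_slice (f : 'rV[R]_n.+1 -> R) : Cc f ->
  RintN f = \int[mu]_t (RintN (f \o rcons_row t)).
Proof. by move=> Cf; rewrite {1}/RintN intRNS_slice. Qed.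

End Slices.

Lemma integral_specP n : integral_spec n.
Proof.
elim: n => [|n Sn].
  split=> [//|//|//|f g _ _ fg|r r0]; first exact: fg.
  by exists 1 => // M f _ _ _ fM; rewrite mulr1; exact: fM.
have mT : measurable [set: R] by [].
split.
- move=> f Cf; rewrite (intRNS_slice Sn Cf).
  by apply: integrable_fin_num => //; exact: (slice_integrable Sn Cf).
- move=> f g Cf Cg.
  rewrite (RintN_slice Sn Cf) (RintN_slice Sn Cg) (RintN_slice Sn (CcD Cf Cg)).
  rewrite -RintegralD//; [|exact: (slice_integrable Sn)|exact: (slice_integrable Sn)].
  by apply: eq_Rintegral => t _; rewrite -(RintN_D Sn)//; exact: Cc_rcons.
- move=> k f Cf; rewrite (RintN_slice Sn Cf) (RintN_slice Sn (CcZ k Cf)).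
  rewrite -RintegralZl//; last exact: (slice_integrable Sn).
  by apply: eq_Rintegral => t _; rewrite -(RintN_Z Sn)//; exact: Cc_rcons.
- move=> f g Cf Cg fg; rewrite (RintN_slice Sn Cf) (RintN_slice Sn Cg).
  apply: le_Rintegral => //; [exact: (slice_integrable Sn)|exact: (slice_integrable Sn)|].
  by move=> t _; apply: (RintN_le Sn); [exact: Cc_rcons|exact: Cc_rcons|move=> y; exact: fg].
- move=> r r0; have [V V0 VP] := RintN_bound Sn r0.
  (* Each slice contributes at most [M * V], and slices vanish off an interval of length [2 * r];
     iterating from the value 1 in dimension 0 builds the volume of the box. *)
  exists (V * (r + r)); first by rewrite mulr_ge0// addr_ge0.
  move=> M f Cf fr M0 fM; rewrite (RintN_slice Sn Cf).
  have JM t : `|RintN (f \o rcons_row t)| <= M * V.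
    by apply: VP => //; [exact: Cc_rcons|exact: box_suppS|move=> x; exact: fM].
  pose J t := RintN (f \o rcons_row t).
  pose D : set R := `[- r, r]%classic.
  have mD : measurable D by exact: measurable_itv.
  have -> : \int[mu]_t J t = \int[mu]_(t in D) J t.
    rewrite [RHS]Rintegral_mkcond; apply: eq_Rintegral => t _.
    rewrite patchE; case: ifPn => // tr.
    apply: (slice_supp Sn fr); rewrite leNgt; apply: contra tr => tr.
    by rewrite inE/= /D/= in_itv/= -ler_norml ltW.
  have iJ : mu.-integrable D (EFin \o J).
    apply: (@integrableS _ _ _ mu setT) => //.
    exact: slice_integrable.
  apply: le_trans (le_normr_Rintegral _ _) _ => //.
  apply: (@le_trans _ _ (\int[mu]_(t in D) (M * V))).
    apply: le_Rintegral => //.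
      exact: integrable_norm.
      have := @continuous_compact_integrable R (fun=> M * V) D; apply.
        exact: segment_compact.
      by apply: continuous_subspaceT; exact: cst_continuous.
    by move=> t _; exact: JM.
  rewrite (@Rintegral_cst _ _ _ mu D _ (M * V))//.
  have -> : fine (mu D) = r + r.
    rewrite /D lebesgue_measure_itv/= lte_fin; case: ltP => /= [_|rr].
      by rewrite opprK.
    by have -> : r = 0; lra.
  by rewrite mulrA.
Qed.

(** By induction the slice integral [J] is positive at 0; being continuous it stays above [J 0 / 2]
    on a short interval, and it is nonnegative elsewhere. *)
Lemma RintN_gt0 n (f : 'rV[R]_n -> R) : Cc f -> (forall x, 0 <= f x) ->
  0 < f 0 -> 0 < RintN f.
Proof.
elim: n f => [//|n IH] f Cf f0 fpos.
have Sn := integral_specP n.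
pose J t := RintN (f \o rcons_row t).
have J_ge0 t : 0 <= J t.
  by apply: fine_ge0; apply: intRN_ge0 => x; rewrite lee_fin; exact: f0.
have J0 : 0 < J 0.
  apply: IH; [exact: Cc_rcons|by move=> x; exact: f0|].
  rewrite /= (_ : rcons_row 0 0 = 0)//; apply/rowP => i; rewrite [RHS]mxE.
  by apply: (@rcons_row_split _ (fun t => t = 0)) => [//|j]; rewrite mxE.
have cJ : J t @[t --> 0] --> J 0 by exact: (slice_continuous Sn Cf).
move/cvgrPdist_lt : cJ => /(_ (J 0 / 2)); rewrite divr_gt0// => /(_ isT) /nbhs_ballP[e /= e0 eJ].
have Je t : t \in `[0, e / 2]%R -> J 0 / 2 <= J t.
  rewrite in_itv/= => /andP[t0 te].
  have : ball (0 : R) e t.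
    by rewrite /ball/= sub0r normrN ger0_norm// (le_lt_trans te)// gtr_pMr// invf_lt1// ltr1n.
  by move=> /eJ /=; rewrite -/(J 0) -/(J t) ltr_norml => /andP[_ Jt]; lra.
rewrite (RintN_slice Sn Cf) -/J.
pose D : set R := `[0, (e / 2)]%classic.
have mD : measurable D by exact: measurable_itv.
have iJ : mu.-integrable setT (EFin \o J) by exact: (slice_integrable Sn Cf).
apply: (@lt_le_trans _ _ (\int[mu]_(t in D) (J 0 / 2))).
  rewrite (@Rintegral_cst _ _ _ mu D _ (J 0 / 2))//.
  have -> : fine (mu D) = e / 2.
    by rewrite /D lebesgue_measure_itv/= lte_fin divr_gt0//= oppr0 addr0.
  by rewrite mulr_gt0// divr_gt0.
apply: (@le_trans _ _ (\int[mu]_(t in D) J t)).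
  apply: le_Rintegral => //.
    have := @continuous_compact_integrable R (fun=> J 0 / 2) D; apply.
      exact: segment_compact.
    by apply: continuous_subspaceT; exact: cst_continuous.
  exact: (integrableS _ _ _ iJ).
rewrite Rintegral_mkcond; apply: le_Rintegral => //.
  by rewrite -restrict_EFin; apply/integrable_restrict => //; rewrite setTI; exact: (integrableS _ _ _ iJ).
by move=> t _; rewrite patchE; case: ifPn => // _; exact: J_ge0.
Qed.

End IteratedIntegral.

(** * Functions of class C^1 *)

Section Calculus.
Variable R : realType.

(** The two difference quotients are the same function. This carries one-variable calculus over to
    directional derivatives without Frechet differentiability. *)
Lemma is_derive_slice (V : normedModType R) (f : V -> R) (z v : V) (h d : R) :
  is_derive (h *: v + z) v f d <-> is_derive h 1 (fun k => f (k *: v + z)) d.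
Proof.
have E : (fun k : R => k^-1 *: ((f \o shift (h *: v + z)) (k *: v) - f (h *: v + z)))
    = (fun k : R => k^-1 *: (((fun l => f (l *: v + z)) \o shift h) (k *: 1)
         - f (h *: v + z))).
  by apply/funext => k /=; rewrite [k%:A]mulr1 addrA -scalerDl.
split=> -[dd <-]; split; rewrite /derivable /derive /=.
- by rewrite -E.
- by rewrite -E.
- by rewrite E.
- by rewrite E.
Qed.

Lemma is_derive_comp (V : normedModType R) (g : R -> R) (f : V -> R) (x v : V)
  (a b : R) :
  is_derive (f x) 1 g a -> is_derive x v f b -> is_derive x v (g \o f) (a * b).
Proof.
move=> ga fb.
have fb0 : is_derive (0 : R) 1 (fun k => f (k *: v + x)) b.
  by apply: (is_derive_slice f x v 0 b).1; rewrite scale0r add0r.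
have ga0 : is_derive (f (0 *: v + x)) 1 g a by rewrite scale0r add0r.
have := (is_derive_slice (g \o f) x v 0 (a * b)).2
  (@is_derive1_comp R g (fun k => f (k *: v + x)) 0 a b ga0 fb0).
by rewrite scale0r add0r.
Qed.

Lemma continuous_sum (T : topologicalType) n (f : 'I_n -> T -> R) :
  (forall i, continuous (f i)) -> continuous (fun x => \sum_i f i x).
Proof.
move=> cf; have -> : (fun x => \sum_i f i x) = \sum_i f i.
  by apply/funext => x; rewrite fct_sumE.
apply: (big_ind (fun g : T -> R => continuous g)) => //.
- exact: cst_continuous.
- by move=> g h cg ch x; apply: continuousD; [exact: cg|exact: ch].
Qed.

Lemma continuous_mul (T : topologicalType) (f g : T -> R) :
  continuous f -> continuous g -> continuous (fun x => f x * g x).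
Proof. by move=> cf cg x; apply: continuousM; [exact: cf|exact: cg]. Qed.

Lemma continuous_add (T : topologicalType) (f g : T -> R) :
  continuous f -> continuous g -> continuous (fun x => f x + g x).
Proof. by move=> cf cg x; apply: continuousD; [exact: cf|exact: cg]. Qed.

Lemma continuous_compose (T : topologicalType) (f : T -> R) (g : R -> R) :
  continuous f -> continuous g -> continuous (fun x => g (f x)).
Proof. by move=> cf cg x; exact: continuous_comp (cf x) (cg (f x)). Qed.

(** Differentiability of the power gives continuity only where [f] is positive. Zeros of [f], which
    occur at critical points of [u], are treated directly with the threshold [e^(1/a)]. *)
Lemma continuous_fun_powR (T : topologicalType) (f : T -> R) (a : R) :
  0 < a -> (forall x, 0 <= f x) -> continuous f ->
  continuous (fun x => f x `^ a).
Proof.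
move=> a0 f0 cf x; change (f y `^ a @[y --> x] --> f x `^ a).
have cfx : f y @[y --> x] --> f x by exact: cf.
have := f0 x; rewrite le_eqVlt => /predU1P[fx|fx].
  rewrite -fx powR0 ?gt_eqF//; apply/cvgr0Pnorm_lt => e e0.
  have d0 : 0 < e `^ a^-1 by rewrite powR_gt0.
  move: cfx; rewrite -fx => /cvgr0Pnorm_lt/(_ _ d0); apply: filterS => y.
  rewrite (ger0_norm (f0 _)) ger0_norm ?powR_ge0// => fy.
  rewrite -[ltRHS](powRr1 (ltW e0)) -(mulVf (lt0r_neq0 a0)) powRrM.
  by rewrite gt0_ltr_powR// ?nnegrE// ltW.
have : {for f x, continuous (fun t => t `^ a)}.
  apply: differentiable_continuous; apply/derivable1_diffP.
  by apply: derivable_powR; rewrite in_itv/= fx.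
by move=> /(continuous_comp (cf x)).
Qed.

Section ContinuouslyDifferentiable.
Variable N : nat.
Implicit Types (f g u : 'rV[R]_N -> R) (x y : 'rV[R]_N).

Lemma C1_is_derive f : C1 f -> forall i x,
  is_derive x (evec R i) f ('D_(evec R i) f x).
Proof. by move=> C1f i x; apply: derivableP; case: (C1f i). Qed.

Lemma C1_grad f (df : 'I_N -> 'rV[R]_N -> R) :
  (forall i x, is_derive x (evec R i) f (df i x)) ->
  (forall i, continuous (df i)) ->
  C1 f /\ forall x, grad f x = \row_i df i x.
Proof.
move=> fdf cdf; have dfE i x : 'D_(evec R i) f x = df i x.
  by have [] := fdf i x.
split; last by move=> x; apply/rowP => i; rewrite !mxE dfE.
move=> i; split; first by move=> x; have [] := fdf i x.
by rewrite (_ : (fun x => _) = df i)//; apply/funext => x; exact: dfE.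
Qed.

(** The mean value theorem on the line through [x] in direction [v]; the two signs of [b] are
    separated because the theorem wants ordered endpoints. *)
Lemma segment_increment f x (v : 'rV[R]_N) (b M : R) : 
  (forall t : R, `|t| <= `|b| -> derivable f (t *: v + x) v) ->
  (forall t : R, `|t| <= `|b| -> `|'D_v f (t *: v + x)| <= M) ->
  `|f (b *: v + x) - f x| <= M * `|b|.
Proof.
move=> df Mf; pose g t := f (t *: v + x).
have dg (t : R) : `|t| <= `|b| -> is_derive t 1 g ('D_v f (t *: v + x)).
  by move=> /df tb; apply: (is_derive_slice f x v t _).1; exact: derivableP.
have cg (t : R) : `|t| <= `|b| -> {for t, continuous g}.
  by move=> /dg [dgt _]; apply: differentiable_continuous; apply/derivable1_diffP.
have g0 : f x = g 0 by rewrite /g scale0r add0r.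
rewrite g0 -/(g b).
have [b0|b0] := leP 0 b.
  have sub (t : R) : 0 <= t <= b -> `|t| <= `|b|.
    by move=> /andP[t0 tb]; rewrite !ger0_norm.
  have [t||c] := @MVT_segment _ g (fun t => 'D_v f (t *: v + x)) 0 b b0.
  - by rewrite in_itv/= => /andP[t0 tb]; apply/dg/sub; rewrite !ltW.
  - apply: continuous_in_subspaceT => t; rewrite inE/= in_itv/= => tb.
    exact/cg/sub.
  - rewrite in_itv/= subr0 => cb ->; rewrite normrM ler_wpM2r//.
    exact/Mf/sub.
have sub (t : R) : b <= t <= 0 -> `|t| <= `|b|.
  by move=> /andP[bt t0]; rewrite !ler0_norm ?lerN2// ltW.
have [t||c] := @MVT_segment _ g (fun t => 'D_v f (t *: v + x)) b 0 (ltW b0).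
- by rewrite in_itv/= => /andP[t0 tb]; apply/dg/sub; rewrite !ltW.
- apply: continuous_in_subspaceT => t; rewrite inE/= in_itv/= => tb.
  exact/cg/sub.
- rewrite in_itv/= sub0r distrC => cb ->; rewrite normrM normrN ler_wpM2r//.
  exact/Mf/sub.
Qed.

(* [f] is compared at [x] and [y] along the polygonal path changing one
   coordinate at a time. *)
Lemma C1_continuous f : C1 f -> continuous f.
Proof.
move=> C1f; suff cf (x : 'rV[R]_N) : f y @[y --> x] --> f x by exact: cf.
have Fx : ProperFilter (nbhs x).
  exact: (@nbhs_pfilter ('rV[R]_N : topologicalType) x).
have xball e : 0 < e -> nbhs x (ball x e).
  exact: (@nbhsx_ballx _ ('rV[R]_N : pseudoMetricType R) x e).
pose z k y : 'rV[R]_N := \row_j (if (j < k)%N then y 0 j else x 0 j).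
have zball k y e : ball x e y -> ball x e (z k y).
  move=> [e0 xy]; split => // i j; rewrite !ord1 mxE.
  by case: ifP => _; [exact: xy|exact: ballxx].
suff fz k : f (z k y) @[y --> x] --> f x.
  have := fz N; rewrite (_ : (fun y => f (z N y)) = f)//.
  by apply/funext => y; congr f; apply/rowP => j; rewrite mxE ltn_ord.
elim: k => [|k IH].
  rewrite (_ : (fun y => f (z 0%N y)) = cst (f x)); first exact: cvg_cst.
  by apply/funext => y; congr f; apply/rowP => j; rewrite mxE.
have [kN|kN] := ltnP k N; last first.
  rewrite (_ : (fun y => f (z k.+1 y)) = fun y => f (z k y))//.
  apply/funext => y; congr f; apply/rowP => j; rewrite !mxE.
  by rewrite !(leq_trans (ltn_ord j))// leqW.
pose i := Ordinal kN; have [df cD] := C1f i.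
rewrite (_ : (fun y => f (z k.+1 y)) = fun y => (f (z k.+1 y) - f (z k y)) + f (z k y));
  last by apply/funext => y; rewrite subrK.
rewrite -[X in _ --> X]add0r; apply: cvgD => //.
(* Continuity bounds the partial derivative by [M] near [x], so changing coordinate [i] moves [f] by
   at most [M * |y_i - x_i|]. *)
have /cvgrPdist_lt/(_ 1 ltr01)/nbhs_ballP[e /= e0 De] := cD x.
pose M := `|'D_(evec R i) f x| + 1.
have DM y : ball x e y -> `|'D_(evec R i) f y| <= M.
  move=> /De /= xy; rewrite /M -lerBlDl; apply: le_trans (lerB_dist _ _) _.
  by rewrite distrC ltW.
have M0 : 0 < M by rewrite ltr_wpDl.
apply/cvgr0Pnorm_le => d d0.
have dM : 0 < d / M by rewrite divr_gt0.
near=> y.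
have xe : ball x e y by near: y; exact: xball.
have xd : ball x (d / M) y by near: y; exact: xball.
have zS t : t *: evec R i + z k y = \row_j (if j == i then t + x 0 i else z k y 0 j).
  apply/rowP => j; rewrite !mxE eqxx /=; case: eqP => [->|]; last by rewrite mulr0 add0r.
  by rewrite ltnn mulr1.
have -> : z k.+1 y = (y 0 i - x 0 i) *: evec R i + z k y.
  rewrite zS; apply/rowP => j; rewrite !mxE ltnS leq_eqVlt.
  case: (eqVneq j i) => [->|ji]; first by rewrite eqxx/= subrK.
  by rewrite -[k]/(i : nat) val_eqE (negPf ji).
(* The points [z k y] still carry [x_i] in coordinate [i], so the segment travelled stays in the
   ball where [M] is valid. *)
apply: le_trans (_ : M * `|y 0 i - x 0 i| <= _).
  apply: segment_increment => t tb; first exact: df.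
  apply: DM; rewrite zS; split => // a j; rewrite !ord1 !mxE.
  case: eqP => [->|_]; last by have [_] := zball k y e xe; move=> /(_ 0 j); rewrite mxE.
  rewrite /ball/= opprD addrCA subrr addr0 normrN (le_lt_trans tb)// distrC.
  by have [_] := xe; exact.
rewrite mulrC -ler_pdivlMr// distrC ltW//; by have [_] := xd; exact.
Unshelve. all: by end_near. Qed.

End ContinuouslyDifferentiable.
End Calculus.

(** * Absorption inequalities *)

Section ScalarInequalities.
Variable R : realType.
Implicit Types p q X Y w z a g r : R.

(** Both sides are homogeneous of degree [p] in [(X, Y)]. For [X] at least [L * Y] the negative
    square dominates and the left side is nonpositive; otherwise [X] is controlled by [L * Y]. The
    summand 1 in the witness makes it strictly positive even when [c1 = c2 = 0]. *)
Lemma young_absorb p kappa c1 c2 : 2 < p -> 0 < kappa -> 0 <= c1 -> 0 <= c2 ->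
  exists2 M : R, 0 < M & forall X Y, 0 <= X -> 0 <= Y ->
    X `^ (p - 2) * (- kappa * X ^+ 2 + c1 * X * Y + c2 * Y ^+ 2) <= M * Y `^ p.
Proof.
move=> p2 k0 c10 c20.
pose L := Num.max 1 ((c1 + c2) / kappa).
have L1 : 1 <= L by rewrite le_max lexx.
have Lk : c1 + c2 <= kappa * L.
  by rewrite mulrC -ler_pdivrMr// le_max lexx orbT.
exists (L `^ (p - 2) * (c1 * L + c2) + 1).
  by rewrite ltr_wpDl// mulr_ge0 ?powR_ge0//; nra.
move=> X Y X0 Y0.
have [LX|XL] := leP (L * Y) X.
  apply: (@le_trans _ _ 0); last first.
    by rewrite mulr_ge0 ?powR_ge0// addr_ge0// mulr_ge0 ?powR_ge0//; nra.
  have YX : Y <= X by nra.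
  have c2YX : c2 * Y ^+ 2 <= c2 * X * Y.
    by rewrite expr2 -mulrA; apply: ler_wpM2l => //; exact: ler_wpM2r.
  have XY0 : 0 <= X * Y by exact: mulr_ge0.
  have cXY : (c1 + c2) * (X * Y) <= kappa * L * (X * Y) by exact: ler_wpM2r.
  have kXY : kappa * X * (L * Y) <= kappa * X * X by apply: ler_wpM2l => //; nra.
  apply: mulr_ge0_le0; first exact: powR_ge0.
  by rewrite expr2; nra.
have Yp : Y `^ p = Y `^ (p - 2) * Y ^+ 2.
  have [->|Yn0] := eqVneq Y 0; first by rewrite !powR0 ?mul0r//; lra.
  rewrite -powR_mulrn// -powRD ?subrK//.
  by rewrite Yn0 implybT.
have XLp : X `^ (p - 2) <= L `^ (p - 2) * Y `^ (p - 2).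
  rewrite -powRM//; last by lra.
  by apply: ge0_ler_powR; rewrite ?nnegrE//; lra || nra.
have br : - kappa * X ^+ 2 + c1 * X * Y + c2 * Y ^+ 2 <= (c1 * L + c2) * Y ^+ 2.
  have h1 : c1 * X * Y <= c1 * (L * Y) * Y.
    by apply: ler_wpM2r => //; apply: ler_wpM2l => //; exact: ltW.
  have h2 : 0 <= kappa * X ^+ 2 by rewrite mulr_ge0 ?sqr_ge0// ltW.
  by lra.
have cY0 : 0 <= (c1 * L + c2) * Y ^+ 2 by rewrite mulr_ge0 ?sqr_ge0//; nra.
apply: (@le_trans _ _ (X `^ (p - 2) * ((c1 * L + c2) * Y ^+ 2))).
  by rewrite ler_wpM2l ?powR_ge0.
apply: (@le_trans _ _ (L `^ (p - 2) * Y `^ (p - 2) * ((c1 * L + c2) * Y ^+ 2))).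
  by rewrite ler_wpM2r.
have := mulr_ge0 (powR_ge0 Y (p - 2)) (sqr_ge0 Y).
by rewrite Yp; lra.
Qed.

(** The left side is nonpositive once [delta * z] reaches [beta]; below that, [z] is replaced by
    [beta / delta] in the power. *)
Lemma powR_absorb q delta beta z : 1 < q -> 0 < delta -> 0 <= beta -> 0 < z ->
  z `^ (q - 1) * (beta - delta * z) <= delta `^ (1 - q) * beta `^ q.
Proof.
move=> q1 d0 b0 z0.
have [bz|zb] := leP beta (delta * z).
  apply: (@le_trans _ _ 0); last by rewrite mulr_ge0 ?powR_ge0.
  by rewrite mulr_ge0_le0 ?powR_ge0// subr_le0.
have zbd : z <= beta / delta by rewrite ler_pdivlMr// mulrC ltW.
have bpos : 0 < beta by rewrite (lt_trans _ zb)// mulr_gt0.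
apply: (@le_trans _ _ ((beta / delta) `^ (q - 1) * beta)); last first.
  rewrite powRM ?invr_ge0 ?(ltW d0)// -powR_inv1 ?(ltW d0)// -powRrM mulN1r opprB.
  rewrite mulrAC mulrC -{2}(powRr1 b0) -powRD ?subrK//.
  by rewrite lt0r_neq0// implybT.
apply: ler_pM.
- exact: powR_ge0.
- by rewrite subr_ge0 ltW.
- by apply: ge0_ler_powR; rewrite ?nnegrE ?divr_ge0//; lra.
- by rewrite gerBl mulr_ge0 ?ltW.
Qed.

(* Here [a = |grad u|], [h] is the cutoff, [g] and [Y] stand for [grad u . v]
   and [|v|] where [v] is the gradient of the quadratic inside the cutoff, and
   [z = e^u]. *)
Lemma energy_density_bound p alpha theta delta (k : nat) :
  2 < p -> 0 < alpha -> (p - 1) * alpha < 2 * theta -> 0 < delta ->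
  (1 <= k)%N -> p * (2 * alpha + 1) <= (2 * k)%:R ->
  exists2 K : R, 0 < K & forall r a h Y g w z, 0 < r -> 0 <= a -> 0 < h <= 1 ->
    0 <= Y <= r^-1 -> `|g| <= a * Y -> 0 < w -> 0 < z ->
    w * a `^ (p - 2) * z `^ (2 * alpha) * h ^+ (2 * k - 2) *
      ((p - 1) * (alpha ^+ 2 * h ^+ 2 * a ^+ 2 + 2 * alpha * k%:R * h * g
                  + k%:R ^+ 2 * Y ^+ 2)
       - theta * (2 * alpha * h ^+ 2 * a ^+ 2 + 2 * k%:R * h * g))
    - delta * (z * z `^ (2 * alpha)) * h ^+ (2 * k)
    <= K * r `^ (- (p * (2 * alpha + 1))) * w `^ (2 * alpha + 1).
Proof.
move=> p2 al0 alth d0 k1 kp.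
set q := 2 * alpha + 1.
have q1 : 1 < q by rewrite /q; lra.
have th0 : 0 < theta by nra.
(* [- kappa] is the coefficient of [(h * a) ^+ 2] in the bracket; it is negative by the condition
   linking [alpha] and [theta]. [c1] collects the cross terms through [|h * g| <= X * Y]. *)
pose kappa := alpha * (2 * theta - (p - 1) * alpha).
pose c1 := 2 * k%:R * ((p - 1) * alpha + theta).
pose c2 := (p - 1) * k%:R ^+ 2.
have k0 : 0 < k%:R :> R by rewrite ltr0n.
have kappa0 : 0 < kappa by rewrite mulr_gt0// subr_gt0.
have c10 : 0 <= c1 by rewrite /c1 mulr_ge0//; nra.
have c20 : 0 <= c2 by rewrite /c2 mulr_ge0 ?sqr_ge0//; lra.
have [M M0 HM] := young_absorb p2 kappa0 c10 c20.
exists (delta `^ (1 - q) * M `^ q); first by rewrite mulr_gt0 ?powR_gt0.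
move=> r a h Y g w z r0 a0 /andP[h0 h1] /andP[Y0 Yr] gaY w0 z0.
have hn0 : h != 0 by rewrite gt_eqF.
pose X := h * a.
have X0 : 0 <= X by rewrite mulr_ge0// ltW.
pose beta := M * w * Y `^ p * h `^ (- p).
have beta0 : 0 <= beta by rewrite /beta !mulr_ge0 ?powR_ge0// ltW.
have hg : `|h * g| <= X * Y.
  by rewrite normrM gtr0_norm// -mulrA ler_pM2l.
have brk : (p - 1) * (alpha ^+ 2 * h ^+ 2 * a ^+ 2 + 2 * alpha * k%:R * h * g
                  + k%:R ^+ 2 * Y ^+ 2)
       - theta * (2 * alpha * h ^+ 2 * a ^+ 2 + 2 * k%:R * h * g)
     <= - kappa * X ^+ 2 + c1 * X * Y + c2 * Y ^+ 2.
  have [hg1 hg2] : - (X * Y) <= h * g /\ h * g <= X * Y.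
    by move: hg; rewrite ler_norml => /andP[].
  have e1 : 2 * k%:R * ((p - 1) * alpha) * (h * g)
       <= 2 * k%:R * ((p - 1) * alpha) * (X * Y).
    by apply: ler_wpM2l => //; rewrite !mulr_ge0//; lra.
  have e2 : 2 * k%:R * theta * (- (h * g)) <= 2 * k%:R * theta * (X * Y).
    by apply: ler_wpM2l; [rewrite !mulr_ge0//; lra|lra].
  by rewrite /kappa /c1 /c2; rewrite /X in e1 e2 *; lra.
have zq : z * z `^ (2 * alpha) = z * z `^ (q - 1) by rewrite /q addrK.
have -> : z `^ (2 * alpha) = z `^ (q - 1) by rewrite /q addrK.
(* Turning [a^(p-2)] into [X^(p-2)] costs a negative power of [h], which is stored in [beta]. *)
have h2k : h ^+ (2 * k - 2) * a `^ (p - 2) = h ^+ (2 * k) * h `^ (- p) * X `^ (p - 2).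
  rewrite /X powRM ?(ltW h0)// -!powR_mulrn ?(ltW h0)// mulrA -!powRD ?hn0 ?implybT//.
  congr (h `^ _ * _); rewrite natrB; first by lra.
  by rewrite -[2%N]muln1 leq_mul2l k1 orbT.
apply: (@le_trans _ _ (h ^+ (2 * k) * (z `^ (q - 1) * (beta - delta * z)))).
  have : w * z `^ (q - 1) * (h ^+ (2 * k) * h `^ (- p)) *
      (X `^ (p - 2) * (- kappa * X ^+ 2 + c1 * X * Y + c2 * Y ^+ 2))
    <= w * z `^ (q - 1) * (h ^+ (2 * k) * h `^ (- p)) * (M * Y `^ p).
    apply: ler_wpM2l (HM _ _ X0 Y0).
    by rewrite !mulr_ge0 ?powR_ge0 ?exprn_ge0// ltW.
  have : w * z `^ (q - 1) * (h ^+ (2 * k - 2) * a `^ (p - 2)) *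
      ((p - 1) * (alpha ^+ 2 * h ^+ 2 * a ^+ 2 + 2 * alpha * k%:R * h * g
                  + k%:R ^+ 2 * Y ^+ 2)
       - theta * (2 * alpha * h ^+ 2 * a ^+ 2 + 2 * k%:R * h * g))
     <= w * z `^ (q - 1) * (h ^+ (2 * k - 2) * a `^ (p - 2)) *
       (- kappa * X ^+ 2 + c1 * X * Y + c2 * Y ^+ 2).
    apply: ler_wpM2l brk.
    by rewrite !mulr_ge0 ?powR_ge0 ?exprn_ge0// ltW.
  rewrite [X in _ <= _ * X * _ -> _]h2k /beta.
  by move: (h ^+ (2 * k - 2)) (_ - theta * _) (- kappa * _ + _ + _) => A B D; lra.
apply: (@le_trans _ _ (h ^+ (2 * k) * (delta `^ (1 - q) * beta `^ q))).
  apply: ler_wpM2l; first by rewrite exprn_ge0// ltW.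
  exact: powR_absorb.
have -> : beta `^ q = M `^ q * w `^ q * Y `^ (p * q) * h `^ (- (p * q)).
  by rewrite /beta !powRM ?mulr_ge0 ?powR_ge0// ?(ltW M0) ?(ltW w0)// -!powRrM mulNr.
(* Here the lower bound on [k] is spent: [h^(2k)] outweighs the [h^(- p q)] coming from [beta^q], as
   [h] is at most 1. *)
have hpow : h ^+ (2 * k) * h `^ (- (p * q)) <= 1.
  rewrite -powR_mulrn ?(ltW h0)// -powRD ?hn0 ?implybT//.
  by rewrite -[leRHS](powRr0 h); apply: ger_powR; [rewrite h0 h1|rewrite subr_ge0].
have Ypow : Y `^ (p * q) <= r `^ (- (p * q)).
  have -> : r `^ (- (p * q)) = r^-1 `^ (p * q).
    by rewrite -powR_inv1 ?(ltW r0)// -powRrM mulN1r.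
  by apply: ge0_ler_powR; rewrite ?nnegrE// ?invr_ge0 ?(ltW r0)//; nra.
have c0 : 0 <= delta `^ (1 - q) * M `^ q * w `^ q by rewrite !mulr_ge0 ?powR_ge0.
have := ler_pM (mulr_ge0 (exprn_ge0 (2 * k) (ltW h0)) (powR_ge0 h (- (p * q))))
  (powR_ge0 Y (p * q)) hpow Ypow.
by rewrite mul1r => /(ler_wpM2l c0); lra.
Qed.

End ScalarInequalities.

(** * Euclidean norm and cutoff functions *)

Section EuclideanNorm.
Variables (R : realType) (N : nat).
Implicit Types a b c x y : 'rV[R]_N.

Lemma dotvC a b : dotv a b = dotv b a.
Proof. by apply: eq_bigr => i _; rewrite mulrC. Qed.

Lemma dotvDl a b c : dotv (a + b) c = dotv a c + dotv b c.
Proof. by rewrite -big_split/=; apply: eq_bigr => i _; rewrite mxE mulrDl. Qed.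

Lemma dotvZl (t : R) a b : dotv (t *: a) b = t * dotv a b.
Proof. by rewrite big_distrr/=; apply: eq_bigr => i _; rewrite mxE mulrA. Qed.

Lemma dotvDr a b c : dotv a (b + c) = dotv a b + dotv a c.
Proof. by rewrite dotvC dotvDl !(dotvC a). Qed.

Lemma dotvZr (t : R) a b : dotv a (t *: b) = t * dotv a b.
Proof. by rewrite dotvC dotvZl dotvC. Qed.

Lemma dotv0r a : dotv a 0 = 0.
Proof. by rewrite -(scale0r a) dotvZr mul0r. Qed.

Lemma dotv_ge0 a : 0 <= dotv a a.
Proof. by apply: sumr_ge0 => i _; rewrite -expr2 sqr_ge0. Qed.

Lemma enorm_ge0 a : 0 <= enorm a.
Proof. exact: sqrtr_ge0. Qed.

Lemma sqr_enorm a : enorm a ^+ 2 = dotv a a.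
Proof. by rewrite sqr_sqrtr// dotv_ge0. Qed.

Lemma coord_le_enorm a i : `|a 0 i| <= enorm a.
Proof.
rewrite -sqrtr_sqr ler_wsqrtr// /dotv (bigD1 i)//= -expr2 lerDl.
by apply: sumr_ge0 => j _; rewrite -expr2 sqr_ge0.
Qed.

Lemma dotv_CauchySchwarz a b : dotv a b ^+ 2 <= dotv a a * dotv b b.
Proof.
have expand t : dotv (a + t *: b) (a + t *: b)
    = dotv a a + 2 * t * dotv a b + t ^+ 2 * dotv b b.
  by rewrite !(dotvDl, dotvDr, dotvZl, dotvZr) (dotvC b a); ring.
have [b0|bn0] := eqVneq (dotv b b) 0.
  have -> : dotv a b = 0.
    apply: big1 => i _; suff -> : b 0 i = 0 by rewrite mulr0.
    apply/eqP; rewrite -normr_eq0 eq_le normr_ge0 andbT.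
    by rewrite (le_trans (coord_le_enorm b i))// /enorm b0 sqrtr0.
  by rewrite b0 mulr0 expr0n.
have bp : 0 < dotv b b by rewrite lt_neqAle eq_sym bn0 dotv_ge0.
have := dotv_ge0 (a + (- (dotv a b / dotv b b)) *: b).
rewrite expand => h.
have : 0 <= (dotv a a - dotv a b ^+ 2 / dotv b b) * dotv b b.
  apply: mulr_ge0 (ltW bp); apply: le_trans h _; rewrite le_eqVlt; apply/orP; left.
  by apply/eqP; field.
by rewrite mulrBl divfK// subr_ge0.
Qed.

Lemma normr_dotv_le a b : `|dotv a b| <= enorm a * enorm b.
Proof.
rewrite -(@ler_pXn2r _ 2)// ?nnegrE ?normr_ge0 ?mulr_ge0 ?enorm_ge0//.
by rewrite real_normK ?num_real// exprMn !sqr_enorm dotv_CauchySchwarz.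
Qed.

Lemma dotv_continuous (T : topologicalType) (f g : T -> 'rV[R]_N) :
  (forall i, continuous (fun z : T => f z 0 i)) ->
  (forall i, continuous (fun z : T => g z 0 i)) ->
  continuous (fun z : T => dotv (f z) (g z)).
Proof.
move=> cf cg; apply: continuous_sum => i x.
by apply: continuousM; [exact: cf|exact: cg].
Qed.

Lemma enorm_continuous (T : topologicalType) (f : T -> 'rV[R]_N) :
  (forall i, continuous (fun z : T => f z 0 i)) ->
  continuous (fun z : T => enorm (f z)).
Proof.
move=> cf x; have cd := dotv_continuous cf cf.
exact: (@continuous_comp _ _ _ (fun z => dotv (f z) (f z)) Num.sqrt x (cd x)
  (@sqrt_continuous R _)).
Qed.

End EuclideanNorm.

Section TestFunctions.
Variables (R : realType) (N : nat).
Implicit Types (x y : 'rV[R]_N) (r : R).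

(** Squaring removes the kink of the positive part. The difference quotient is within [|h|] of the
    claimed derivative, by cases on the signs of [t] and [t + h]. *)
Lemma is_derive_sqr_pos (t : R) :
  is_derive t 1 (fun t => Num.max t 0 ^+ 2) (2 * Num.max t 0).
Proof.
suff cv : h^-1 *: (((fun t => Num.max t 0 ^+ 2) \o shift t) (h *: 1)
    - Num.max t 0 ^+ 2) @[h --> 0^'] --> 2 * Num.max t 0.
  by split; [exact: (cvgP _ cv)|exact: (cvg_lim _ cv)].
apply/cvgrPdist_le => e e0; near=> h.
have h0 : h != 0 by near: h; exact: nbhs_dnbhs_neq.
have he : `|h| <= e.
  near: h; apply: nbhs_dnbhs; apply: filterS (nbhsx_ballx (0 : R) e e0) => k.
  by rewrite /ball/= sub0r normrN => /ltW.
apply: le_trans he; rewrite /= [h%:A]mulr1.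
rewrite -(@ler_pM2l _ `|h|) ?normr_gt0// -normrM mulrBr -[_ *: _]/(_ * _) mulVKf//.
rewrite -normrM -expr2 [`|h ^+ 2|]ger0_norm ?sqr_ge0// [(h + t)]addrC.
have := sqr_ge0 h; have := sqr_ge0 (h + t); rewrite !expr2.
have [t0|t0] := leP t 0; have [ht|ht] := leP (t + h) 0; rewrite ler_norml;
  by move=> A B; apply/andP; split; nra.
Unshelve. all: by end_near. Qed.

Lemma pos_continuous : continuous (fun t : R => Num.max t 0).
Proof.
move=> t; apply/cvgrPdist_lt => e e0.
apply: filterS (nbhsx_ballx (t : R) e e0) => s; rewrite /ball/= !ltr_norml.
by move=> /andP[? ?]; apply/andP; case: (leP t 0); case: (leP s 0); split; lra.
Qed.

(** For positive [r] this is positive exactly on the ball of radius [2 * r], where its gradient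
    [- x / (2 r^2)] has norm at most [1 / r]. *)
Definition bowl r x : R := 1 - (4 * r ^+ 2)^-1 * dotv x x.

Definition bowl_grad r x : 'rV[R]_N := - (2 * r ^+ 2)^-1 *: x.

Definition cutoff r x : R := Num.max (bowl r x) 0.

Lemma coord_continuous_rV (i : 'I_N) : continuous (fun x : 'rV[R]_N => x 0 i).
Proof. exact: coord_continuous. Qed.

Lemma is_derive_bowl r x i : is_derive x (evec R i) (bowl r) (bowl_grad r x 0 i).
Proof.
have e1 : dotv (evec R i) (evec R i) = 1.
  rewrite /dotv (bigD1 i)//= big1 ?addr0 => [|j /negPf ji].
    by rewrite !mxE !eqxx mulr1.
  by rewrite !mxE ji andbF mulr0.
have ex : dotv (evec R i) x = x 0 i.
  rewrite /dotv (bigD1 i)//= big1 ?addr0 => [|j /negPf ji].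
    by rewrite !mxE !eqxx mul1r.
  by rewrite !mxE ji andbF mul0r.
have slice : is_derive (0 : R) 1 (fun k => bowl r (k *: evec R i + x))
    (bowl_grad r x 0 i).
  rewrite (_ : (fun k => _) = (fun k => bowl r x
      - (4 * r ^+ 2)^-1 * (k ^+ 2 + 2 * x 0 i * k))).
    apply: is_derive_eq.
    rewrite !mxE -![_ *: _]/(_ * _) !invfM.
    by move: (r ^+ 2)^-1 => c; lra.
  apply/funext => k; rewrite /bowl !(dotvDl, dotvDr, dotvZl, dotvZr) e1 (dotvC x) ex.
  by ring.
have := (is_derive_slice (bowl r) x (evec R i) 0 _).2 slice.
by rewrite scale0r add0r.
Qed.

Lemma cutoff_continuous r : continuous (cutoff r).
Proof.
move=> x; apply: (@continuous_comp _ _ _ (bowl r) (fun t : R => Num.max t 0));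
  last exact: pos_continuous.
apply: continuousB; first exact: cst_continuous.
apply: continuousM; first exact: cst_continuous.
by apply: dotv_continuous; exact: coord_continuous_rV.
Qed.

Lemma cutoff_ge0 r x : 0 <= cutoff r x.
Proof. by rewrite le_max lexx orbT. Qed.

Lemma cutoff_le1 r x : cutoff r x <= 1.
Proof.
rewrite ge_max ler01 andbT gerBl mulr_ge0 ?dotv_ge0//.
by rewrite invr_ge0 mulr_ge0// sqr_ge0.
Qed.

Lemma cutoff_gt0 r x : 0 < r -> 0 < cutoff r x -> enorm x < 2 * r.
Proof.
move=> r0; rewrite lt_max ltxx orbF subr_gt0 mulrC ltr_pdivrMr ?mulr_gt0 ?exprn_gt0//.
rewrite mul1r -sqr_enorm => h.
rewrite -(@ltr_pXn2r _ 2)// ?nnegrE ?enorm_ge0 ?mulr_ge0 ?ltW//.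
by rewrite exprMn -natrX.
Qed.

Lemma cutoff_supp r x : 0 < r -> 2 * r <= enorm x -> cutoff r x = 0.
Proof.
move=> r0 rx; apply/eqP; rewrite eq_le cutoff_ge0 andbT leNgt; apply/negP.
by move=> /(cutoff_gt0 r0); rewrite ltNge rx.
Qed.

Lemma cutoff_mono r s x : 0 < r -> r <= s -> cutoff r x <= cutoff s x.
Proof.
move=> r0 rs; rewrite ge_max [0 <= _]cutoff_ge0 andbT le_max; apply/orP; left.
rewrite lerD2l lerN2; apply: ler_wpM2r; first exact: dotv_ge0.
have s0 : 0 < s by exact: lt_le_trans rs.
rewrite lef_pV2 ?posrE ?mulr_gt0 ?exprn_gt0// ler_pM2l//.
by rewrite ler_pXn2r// nnegrE ltW.
Qed.

Lemma cutoff0 r : cutoff r 0 = 1.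
Proof.
by rewrite /cutoff /bowl dotv0r mulr0 subr0 max_l.
Qed.

Lemma enorm_bowl_grad r x : 0 < r -> 0 < cutoff r x -> enorm (bowl_grad r x) <= r^-1.
Proof.
move=> r0 /(cutoff_gt0 r0) xr.
have rV : 0 <= r^-1 by rewrite invr_ge0 ltW.
rewrite -(@ler_pXn2r _ 2)// ?nnegrE ?enorm_ge0//.
rewrite sqr_enorm /bowl_grad dotvZl dotvZr -sqr_enorm.
have x2 : enorm x ^+ 2 <= (2 * r) ^+ 2.
  by rewrite ler_pXn2r ?nnegrE ?enorm_ge0 ?mulr_ge0 ?ltW.
have c0 : 0 <= (2 * r ^+ 2)^-1 ^+ 2 by rewrite sqr_ge0.
have := ler_wpM2l c0 x2.
have -> : (2 * r ^+ 2)^-1 ^+ 2 * (2 * r) ^+ 2 = r^-1 ^+ 2.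
  by field; rewrite gt_eqF.
by rewrite mulrA mulrNN -expr2.
Qed.

(** An even power is a power of the squared positive part, so the chain rule never meets the kink of
    the cutoff. *)
Lemma is_derive_cutoff r m x i :
  is_derive x (evec R i) (fun x => cutoff r x ^+ (2 * m.+1))
    ((2 * m.+1)%:R * cutoff r x ^+ (2 * m.+1).-1 * bowl_grad r x 0 i).
Proof.
have h : is_derive x (evec R i) ((fun x => cutoff r x ^+ 2) ^+ m.+1)
    ((m.+1%:R * (cutoff r x ^+ 2) ^+ m) *: (2 * cutoff r x * bowl_grad r x 0 i)).
  apply: is_deriveX.
  apply: (@is_derive_comp _ _ (fun t : R => Num.max t 0 ^+ 2) (bowl r)).
    exact: is_derive_sqr_pos.
  exact: is_derive_bowl.
rewrite (_ : (fun x => _) = (fun x => cutoff r x ^+ 2) ^+ m.+1); last first.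
  by apply/funext => y; rewrite fctE exprM.
apply: is_derive_eq.
have -> : (2 * m.+1).-1 = (2 * m).+1 by rewrite mulnS.
by rewrite -[_ *: _]/(_ * _) -exprM exprS natrM; ring.
Qed.

End TestFunctions.

(** * The energy estimate *)

Section EnergyEstimate.
Variables (R : realType) (N : nat).
Implicit Types (x : 'rV[R]_N) (f u w : 'rV[R]_N -> R) (r p : R).

Lemma grad_coord_continuous f (i : 'I_N) : C1 f -> continuous (fun x => grad f x 0 i).
Proof.
move=> C1f; rewrite (_ : (fun x => grad f x 0 i) = fun x => 'D_(evec R i) f x).
  by case: (C1f i).
by apply/funext => x; rewrite mxE.
Qed.

Lemma Cc_cutoff r f : 0 < r -> continuous f ->
  (forall x, cutoff r x = 0 -> f x = 0) -> Cc f.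
Proof.
move=> r0 cf f0; split=> //; exists (2 * r) => x i rx.
by apply/f0/cutoff_supp => //; exact: le_trans rx (coord_le_enorm x i).
Qed.

(** Expresses all powers of the cutoff through the factor [c ^+ k.-1] of the gradient of the test
    function, so that [ring] sees a single atom. *)
Lemma expr_even_split (c : R) m (k := (2 * m.+1)%N) :
  c ^+ (2 * k - 2) = (c ^+ k.-1) ^+ 2 /\ c ^+ k = c * c ^+ k.-1.
Proof.
split; last by rewrite -exprS.
by rewrite -exprM; congr (_ ^+ _); rewrite /k; lia.
Qed.

(** With [f] in the stability inequality and [f ^+ 2] in the equation, the exponential terms of both
    are the same integral. *)
Lemma C1c_sqr f : C1c f -> C1c (fun x => f x ^+ 2) /\
  forall x, grad (fun x => f x ^+ 2) x = (2 * f x) *: grad f x.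
Proof.
move=> [C1f [r fr]].
have [] := @C1_grad R N (fun x => f x ^+ 2) (fun i x => 2 * f x * 'D_(evec R i) f x).
- move=> i x; have := is_deriveX 2 (C1_is_derive C1f i x).
  by rewrite /= expr1.
- move=> i; apply: continuous_mul; last by case: (C1f i).
  by apply: continuous_mul; [exact: cst_continuous|exact: C1_continuous].
move=> C1f2 gf2; split.
  by split => //; exists r => x rx; rewrite fr// expr0n.
by move=> x; rewrite gf2; apply/rowP => i; rewrite !mxE.
Qed.

Definition test_fun u (al : R) r (k : nat) x : R :=
  expR (al * u x) * cutoff r x ^+ k.

(** Outside the support of the cutoff [bowl_grad] does not vanish, but the common factor
    [cutoff r x ^+ k.-1] does, since [k.-1] is positive. *)
Lemma test_fun_C1c u al r m (k := (2 * m.+1)%N) : C1 u -> 0 < r ->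
  C1c (test_fun u al r k) /\
  forall x, grad (test_fun u al r k) x =
    (expR (al * u x) * cutoff r x ^+ k.-1) *:
      ((al * cutoff r x) *: grad u x + k%:R *: bowl_grad r x).
Proof.
move=> C1u r0; have cu := C1_continuous C1u.
have cE : continuous (fun x => expR (al * u x)).
  apply: continuous_compose; last exact: continuous_expR.
  by apply: continuous_mul => //; exact: cst_continuous.
have ccut j : continuous (fun x => cutoff r x ^+ j).
  by apply: continuous_compose (@exprn_continuous R j); exact: cutoff_continuous.
have [] := @C1_grad R N (test_fun u al r k) (fun i x =>
  (expR (al * u x) * cutoff r x ^+ k.-1) *
      (al * cutoff r x * 'D_(evec R i) u x + k%:R * bowl_grad r x 0 i)).
- move=> i x.
  have dau : is_derive x (evec R i) (al *: u) (al *: 'D_(evec R i) u x).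
    by apply: is_deriveZ; exact: C1_is_derive.
  have dE : is_derive x (evec R i) (expR \o (al *: u))
      (expR (al * u x) * (al * 'D_(evec R i) u x)).
    by apply: is_derive_comp dau; exact: is_derive_expR.
  have := is_deriveM dE (is_derive_cutoff r m x i).
  rewrite (_ : (expR \o (al *: u)) * (fun x => cutoff r x ^+ (2 * m.+1))
    = test_fun u al r k)//.
  move=> h; apply: is_derive_eq; rewrite -/k.
  have -> : cutoff r x ^+ k = cutoff r x * cutoff r x ^+ k.-1 by rewrite -exprS.
  rewrite -[X in X + _ = _]/(_ * _) -[X in _ + X = _]/(_ * _).
  rewrite -[(expR \o _) x]/(expR (al * u x)) -/k.
  by move: (cutoff r x ^+ k.-1) => c; ring.
- move=> i; apply: continuous_mul; first exact: continuous_mul.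
  apply: continuous_add.
    apply: continuous_mul; last by case: (C1u i).
    by apply: continuous_mul; [exact: cst_continuous|exact: cutoff_continuous].
  apply: continuous_mul; first exact: cst_continuous.
  rewrite (_ : (fun x => bowl_grad r x 0 i) = fun x => - (2 * r ^+ 2)^-1 * x 0 i).
    by apply: continuous_mul; [exact: cst_continuous|exact: coord_continuous_rV].
  by apply/funext => y; rewrite mxE.
move=> C1f gf; split.
  split => //; exists (2 * r) => x rx.
  by rewrite /test_fun cutoff_supp// expr0n mulr0.
by move=> x; rewrite gf; apply/rowP => i; rewrite !mxE.
Qed.

Definition test_mass u (al : R) r (k : nat) : R :=
  RintN (fun x => expR (u x) * test_fun u al r k x ^+ 2).

Lemma Cc_mass u al r m : C1 u -> 0 < r ->
  Cc (fun x => expR (u x) * test_fun u al r (2 * m.+1) x ^+ 2).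
Proof.
move=> C1u r0; have [[C1f _] _] := test_fun_C1c al m C1u r0.
apply: (Cc_cutoff r0).
  apply: continuous_mul.
    by apply: continuous_compose (@continuous_expR R); exact: C1_continuous.
  by apply: continuous_compose (@exprn_continuous R 2); exact: C1_continuous.
by move=> x cx; rewrite /test_fun cx expr0n /= mulr0 expr0n mulr0.
Qed.

Lemma test_mass_gt0 u al r m : C1 u -> 0 < r -> 0 < test_mass u al r (2 * m.+1).
Proof.
move=> C1u r0; apply: RintN_gt0; first exact: Cc_mass.
- by move=> x; rewrite mulr_ge0 ?sqr_ge0 ?expR_ge0.
- by rewrite /test_fun cutoff0 expr1n mulr1 mulr_gt0 ?exprn_gt0 ?expR_gt0.
Qed.

Lemma test_mass_mono u al r s m : C1 u -> 0 < r -> r <= s ->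
  test_mass u al r (2 * m.+1) <= test_mass u al s (2 * m.+1).
Proof.
move=> C1u r0 rs; have s0 : 0 < s by exact: lt_le_trans rs.
apply: (RintN_le (integral_specP R N)); [exact: Cc_mass|exact: Cc_mass|].
move=> x; apply: ler_wpM2l; first exact: expR_ge0.
have c0 t : 0 <= test_fun u al t (2 * m.+1) x.
  by rewrite mulr_ge0 ?expR_ge0 ?exprn_ge0 ?cutoff_ge0.
rewrite ler_pXn2r ?nnegrE//.
apply: ler_wpM2l; first exact: expR_ge0.
by rewrite ler_pXn2r ?nnegrE ?cutoff_ge0// cutoff_mono.
Qed.

Section Weight.
Variables (w : 'rV[R]_N -> R) (u : 'rV[R]_N -> R) (p : R).
Hypotheses (p2 : 2 < p) (C1w : C1 w) (w0 : forall x, 0 < w x) (C1u : C1 u).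

Let flux_continuous : continuous (fun x => w x * enorm (grad u x) `^ (p - 2)).
Proof.
apply: continuous_mul; first exact: C1_continuous.
apply: continuous_fun_powR => [|y|]; [by rewrite subr_gt0|exact: enorm_ge0|].
by apply: enorm_continuous => i; exact: grad_coord_continuous.
Qed.

(** By Cauchy-Schwarz the term with exponent [p - 4] is at most the first integrand, which gives the
    factor [1 + (p - 2) = p - 1]. The comparison passes to integrals by monotonicity for nonnegative
    functions. *)
Lemma stable_ineq f : stable w p u -> C1c f ->
  Cc (fun x => w x * enorm (grad u x) `^ (p - 2) * enorm (grad f x) ^+ 2) ->
  Cc (fun x => expR (u x) * f x ^+ 2) ->
  RintN (fun x => expR (u x) * f x ^+ 2) <= (p - 1) *
    RintN (fun x => w x * enorm (grad u x) `^ (p - 2) * enorm (grad f x) ^+ 2).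
Proof.
move=> st C1f; set F1 := fun x => _ * enorm (grad f x) ^+ 2.
set F3 := fun x => expR _ * _ => CF1 CF3.
pose F2 x := w x * enorm (grad u x) `^ (p - 4) * dotv (grad u x) (grad f x) ^+ 2.
have F20 x : 0 <= F2 x.
  by apply: mulr_ge0 (sqr_ge0 _); apply: mulr_ge0 (powR_ge0 _ _); exact: ltW.
have F21 x : F2 x <= F1 x.
  rewrite /F2 /F1 -!mulrA ler_pM2l//.
  have := dotv_CauchySchwarz (grad u x) (grad f x); rewrite -!sqr_enorm.
  (* At a critical point of [u] the inner product vanishes, so the value given to a possibly
     negative power of 0 does not matter. *)
  set a := enorm (grad u x); have [a0|an0] := eqVneq a 0.
    rewrite a0 expr0n mul0r => h.
    have -> : dotv (grad u x) (grad f x) ^+ 2 = 0.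
      by apply/eqP; rewrite eq_le h sqr_ge0.
    by rewrite mulr0 mulr_ge0 ?powR_ge0 ?sqr_ge0.
  move=> h; apply: le_trans (ler_wpM2l (powR_ge0 a (p - 4)) h) _.
  rewrite mulrA -powR_mulrn ?enorm_ge0// -powRD ?an0 ?implybT//.
  by rewrite (_ : p - 4 + 2%:R = p - 2)//; lra.
have := st f C1f.
rewrite -[intRN _]/(intRN (EFin \o F1)).
rewrite -[X in (_ + _ * X - _)%E]/(intRN (EFin \o F2)).
rewrite -[X in (_ + _ - X)%E]/(intRN (EFin \o F3)).
have S := integral_specP R N.
have I1 := Cc_fin S CF1; have I3 := Cc_fin S CF3.
have L2 : (intRN (EFin \o F2) <= intRN (EFin \o F1))%E.
  by apply: ge0_le_intRN => x; rewrite lee_fin.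
have p20 : (0 <= (p - 2)%:E)%E by rewrite lee_fin subr_ge0 ltW.
move=> st0.
have {st0} : (0 <= intRN (EFin \o F1) + (p - 2)%:E * intRN (EFin \o F1)
   - intRN (EFin \o F3))%E.
  by apply: le_trans st0 _; apply: leeD => //; apply: leeD => //; exact: lee_wpmul2l.
have -> : (intRN (EFin \o F1) + (p - 2)%:E * intRN (EFin \o F1)
   - intRN (EFin \o F3))%E = (RintN F1 + (p - 2) * RintN F1 - RintN F3)%:E.
  by rewrite -(fineK I1) -(fineK I3).
by rewrite lee_fin; lra.
Qed.

Lemma weak_eq f : weak_solution w p u -> C1c f ->
  Cc (fun x => w x * enorm (grad u x) `^ (p - 2) * dotv (grad u x) (grad f x)) ->
  Cc (fun x => expR (u x) * f x) ->
  RintN (fun x => w x * enorm (grad u x) `^ (p - 2) * dotv (grad u x) (grad f x)) =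
  RintN (fun x => expR (u x) * f x).
Proof.
move=> ws C1f; set W := fun x => _ * dotv _ _; set F := fun x => expR _ * _.
move=> CW CF; have S := integral_specP R N.
have := ws f C1f.
rewrite -[intRN _]/(intRN (EFin \o W)) -[X in (_ - X)%E]/(intRN (EFin \o F)).
rewrite -(fineK (Cc_fin S CW)) -(fineK (Cc_fin S CF)) -EFinB => -[] /eqP.
by rewrite subr_eq0 => /eqP.
Qed.

(** Stability and the equation bound the integral of [D] below by [1 - theta - delta] times the
    mass, while the density bound dominates [D] pointwise by a multiple of [w^q] on the ball of
    radius [2 * r]. *)
Lemma energy_estimate C (al theta delta : R) m (k := (2 * m.+1)%N)
    (q := 2 * al + 1) (Q := (p + 3) / (p - 1)) :
  0 < C -> (forall x, C < w x) -> weak_solution w p u -> stable w p u ->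
  0 < al -> (p - 1) * al < 2 * theta -> 0 < delta -> p * q <= (2 * k)%:R ->
  q <= Q ->
  exists2 K : R, 0 < K & forall r A, 0 < r -> (A_R w p r <= A%:E)%E ->
    (1 - theta - delta) * test_mass u al r k <= K * r `^ (- (p * q)) * A.
Proof.
move=> C0 Cw ws st al0 alth d0 pqk qQ.
have [K K0 HK] := energy_density_bound p2 al0 alth d0 (isT : (1 <= k)%N) pqk.
have Cp : 0 < C `^ (q - Q) by rewrite powR_gt0.
exists (K * C `^ (q - Q)); first by rewrite mulr_gt0.
move=> r A r0 HA; have S := integral_specP R N.
have [C1cf gf] := test_fun_C1c al m C1u r0; have [C1cf2 gf2] := C1c_sqr C1cf.
set f := test_fun u al r k in C1cf gf C1cf2 gf2.
have gf0 x : cutoff r x = 0 -> grad f x = 0.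
  have k1 : k.-1 = (2 * m).+1 by rewrite /k mulnS.
  by move=> cx; rewrite gf cx k1 expr0n mulr0 scale0r.
pose F1 x := w x * enorm (grad u x) `^ (p - 2) * enorm (grad f x) ^+ 2.
pose F3 x := expR (u x) * f x ^+ 2.
pose W x := w x * enorm (grad u x) `^ (p - 2)
             * dotv (grad u x) (grad (fun y => f y ^+ 2) x).
have CF1 : Cc F1.
  apply: CcM => //; apply: (Cc_cutoff r0).
    rewrite (_ : (fun x => _) = fun x => dotv (grad f x) (grad f x)).
      by apply: dotv_continuous => i; apply: grad_coord_continuous; case: C1cf.
    by apply/funext => x; rewrite sqr_enorm.
  by move=> x /gf0 ->; rewrite sqr_enorm dotv0r.
have CF3 : Cc F3 by exact: Cc_mass.
have CW : Cc W.
  apply: CcM => //; apply: (Cc_cutoff r0).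
    by apply: dotv_continuous => i; apply: grad_coord_continuous => //; case: C1cf2.
  by move=> x /gf0 g0; rewrite gf2 g0 scaler0 dotv0r.
have I13 := stable_ineq st C1cf CF1 CF3.
have IW3 := weak_eq ws C1cf2 CW CF3.
rewrite -/F1 -/F3 -/W in I13 IW3.
pose D : 'rV[R]_N -> R := ((p - 1) \*o F1) \+ ((- theta \*o W) \+ (- delta \*o F3)).
have CD : Cc D by apply: CcD; [exact: CcZ|apply: CcD; exact: CcZ].
have ED : RintN D = (p - 1) * RintN F1 - (theta + delta) * RintN F3.
  rewrite /D (RintN_D S); [|exact: CcZ|by apply: CcD; exact: CcZ].
  rewrite (RintN_D S); [|exact: CcZ|exact: CcZ].
  by rewrite !(RintN_Z S)// IW3; ring.
(* Comparison with the integral [A_R] rests on monotonicity, which is stated for nonnegative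
   integrands; the positive part of [D] is still continuous with compact support. *)
pose Dp x := Num.max (D x) 0.
pose L := K * C `^ (q - Q) * r `^ (- (p * q)).
have L0 : 0 < L by rewrite !mulr_gt0// powR_gt0.
have CDp : Cc Dp.
  case: CD => cD [s Ds]; split.
    exact: continuous_compose cD (@pos_continuous R).
  by exists s => x i sx; rewrite /Dp (Ds x i)// maxxx.
have DL (x : 'rV[R]_N) : Dp x <= L * (\1_(@Defs.ball0 R N (2 * r)) x * w x `^ Q).
  have c_ge0 := cutoff_ge0 r x.
  have rhs_ge0 : 0 <= L * (\1_(@Defs.ball0 R N (2 * r)) x * w x `^ Q).
    apply: mulr_ge0; first exact: ltW.
    by apply: mulr_ge0; [rewrite indicE ler0n|exact: powR_ge0].
  rewrite ge_max rhs_ge0 andbT.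
  (* The density bound assumes a positive cutoff; where the cutoff is zero, [D] is zero too. *)
  have [cx|cx0] := eqVneq (cutoff r x) 0.
    apply: (@le_trans _ _ 0).
      rewrite /D /F1 /W /F3 /= gf2 (gf0 _ cx) scaler0.
      rewrite sqr_enorm !dotv0r /f /test_fun cx expr0n /= !mulr0 expr0n /=.
      by rewrite !mulr0 !addr0.
    exact: rhs_ge0.
  have c_gt0 : 0 < cutoff r x by rewrite lt_neqAle eq_sym cx0.
  have xB : x \in @Defs.ball0 R N (2 * r) by rewrite inE; exact: cutoff_gt0.
  rewrite indicE xB mul1r.
  (* Since [q - Q] is nonpositive, the lower bound [C] on [w] bounds [w^(q - Q)] from above. *)
  have wQ : w x `^ q <= C `^ (q - Q) * w x `^ Q.
    have -> : w x `^ q = w x `^ (q - Q) * w x `^ Q.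
      by rewrite -powRD ?subrK// lt0r_neq0// implybT.
    apply: ler_wpM2r; first exact: powR_ge0.
    have qQ0 : 0 <= Q - q by rewrite subr_ge0.
    rewrite -(opprB Q q) !powRN lef_pV2 ?posrE ?powR_gt0//.
    by apply: ge0_ler_powR; rewrite ?nnegrE// ltW.
  have cr : 0 < cutoff r x <= 1 by rewrite c_gt0 cutoff_le1.
  have br : 0 <= enorm (bowl_grad r x) <= r^-1.
    by rewrite enorm_ge0 enorm_bowl_grad.
  have := HK r (enorm (grad u x)) (cutoff r x) (enorm (bowl_grad r x))
    (dotv (grad u x) (bowl_grad r x)) (w x) (expR (u x)) r0 (enorm_ge0 _) cr br
    (normr_dotv_le _ _) (w0 x) (expR_gt0 _).
  have E2 : expR (u x) `^ (2 * al) = expR (al * u x) ^+ 2.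
    by rewrite /powR gt_eqF ?expR_gt0// expRK expr2 -expRD; congr expR; ring.
  rewrite E2.
  have -> : w x * enorm (grad u x) `^ (p - 2) * expR (al * u x) ^+ 2 *
      cutoff r x ^+ (2 * k - 2) *
      ((p - 1) * (al ^+ 2 * cutoff r x ^+ 2 * enorm (grad u x) ^+ 2
         + 2 * al * k%:R * cutoff r x * dotv (grad u x) (bowl_grad r x)
         + k%:R ^+ 2 * enorm (bowl_grad r x) ^+ 2)
       - theta * (2 * al * cutoff r x ^+ 2 * enorm (grad u x) ^+ 2
         + 2 * k%:R * cutoff r x * dotv (grad u x) (bowl_grad r x)))
      - delta * (expR (u x) * expR (al * u x) ^+ 2) * cutoff r x ^+ (2 * k)
    = D x.
    rewrite /D /F1 /W /F3 /= gf2 gf !sqr_enorm /f /test_fun.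
    move: (bowl_grad r x) (grad u x) => b g.
    rewrite !(dotvDl, dotvDr, dotvZl, dotvZr) (dotvC b g).
    have [-> ck] := expr_even_split (cutoff r x) m.
    rewrite (mulnC 2%N k) exprM ck.
    by rewrite -/k; move: (cutoff r x ^+ k.-1) (k%:R) => d n; ring.
  move=> /le_trans; apply.
  have Kr0 : 0 <= K * r `^ (- (p * q)) by rewrite mulr_ge0 ?powR_ge0// ltW.
  by have := ler_wpM2l Kr0 wQ; rewrite /L; lra.
(* Dividing by [L] on the continuous side leaves exactly the integrand of [A_R] as the majorant, so
   no scalar has to be pulled out of that integral. *)
have IDp : L^-1 * RintN Dp <= A.
  rewrite -(RintN_Z S)// -lee_fin fineK ?(Cc_fin S)//; last exact: CcZ.
  apply: le_trans HA; apply: ge0_le_intRN => x; rewrite lee_fin /=.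
    by rewrite mulr_ge0 ?invr_ge0 ?(ltW L0)// le_max lexx orbT.
  by rewrite ler_pdivrMl.
have IDDp : RintN D <= RintN Dp.
  by apply: (RintN_le S) => // x; rewrite /Dp le_max lexx.
move: IDp; rewrite ler_pdivrMl// => IDp.
have : (1 - theta - delta) * RintN F3 <= L * A by lra.
by rewrite /L /test_mass -/f -/F3; lra.
Qed.

End Weight.
End EnergyEstimate.

(** * Choice of the exponents and contradiction for large radii *)

Lemma leq_even_bound (n : nat) : (n <= 2 * (2 * n.+1))%N.
Proof. lia. Qed.

Unset Implicit Arguments.

Theorem theorem1 (R : realType) (N : nat) (p C mu : R) (w : 'rV[R]_N -> R) :
  (1 <= N)%N -> 2 < p ->
  C1 w -> 0 < C -> (forall x, C < w x) ->
  (exists K R0 : R, forall r : R, R0 <= r -> (A_R w p r <= (K * r `^ mu)%:E)%E) ->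
  mu < p * (p + 3) / (p - 1) ->
  forall zeta : R, 0 < zeta < 1 ->
    ~ exists u : 'rV[R]_N -> R,
        C1zeta_loc zeta u /\ weak_solution w p u /\ stable w p u.
Proof.
move=> _ p2 C1w C0 Cw [K1 [R0 HA]] mup zeta _ [u [[C1u _] [ws st]]].
have w0 x : 0 < w x by exact: lt_trans (Cw x).
pose s := p * (p + 3) / (p - 1) - mu.
(* The critical exponent is [p + B], because [p + 3 = (p - 1) + 4]; [s] is the distance of [mu] from
   it. *)
pose B := 4 * p / (p - 1).
have p1 : 0 < p - 1 by lra.
have s0 : 0 < s by rewrite subr_gt0.
have B0 : 0 < B by rewrite divr_gt0//; lra.
(* [tau] measures how close [al] is to [2 / (p - 1)]. Since [p * q = p + tau * B], the gain
   [p * q - mu] is [s - (1 - tau) * B], and this choice makes it [s * (1 - tau)], which is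
   positive. *)
pose tau := B / (s + B).
have sB0 : 0 < s + B by exact: addr_gt0.
have tau0 : 0 < tau by exact: divr_gt0.
have tau1 : tau < 1 by rewrite ltr_pdivrMr// mul1r ltrDr.
pose al := 2 * tau / (p - 1); pose q := 2 * al + 1.
have al0 : 0 < al by rewrite divr_gt0// mulr_gt0.
have pal : (p - 1) * al = 2 * tau by rewrite mulrC divfK// gt_eqF.
have pq : p * q = p + tau * B.
  by rewrite /q /al /B; field; rewrite gt_eqF.
have gap : 0 < p * q - mu.
  have -> : p * q - mu = s - (1 - tau) * B.
    by rewrite pq /s /B; field; rewrite gt_eqF.
  have -> : (1 - tau) * B = s * tau by rewrite /tau; field; rewrite gt_eqF.
  by rewrite subr_gt0 gtr_pMr.
have qQ : q <= (p + 3) / (p - 1).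
  rewrite ler_pdivlMr// /q mulrDl mul1r -mulrA (mulrC al) pal; lra.
pose m := Num.bound (p * q).
have pqk : p * q <= (2 * (2 * m.+1))%:R.
  have pq0 : 0 <= p * q by rewrite pq; nra.
  by apply/ltW/(lt_le_trans (archi_boundP pq0)); rewrite ler_nat leq_even_bound.
(* [theta] is the midpoint of [tau] and 1, and [delta] is half of what remains, so
   [1 - theta - delta = (1 - tau) / 4]. *)
have th : (p - 1) * al < 2 * ((1 + tau) / 2) by rewrite pal; lra.
have d0 : 0 < (1 - tau) / 4 by lra.
have [K K0 HK] :=
  energy_estimate p2 C1w w0 C1u C0 Cw ws st al0 th d0 pqk qQ.
(* The mass at radius 1 is a fixed positive lower bound for the mass at every larger radius. *)
pose E := (1 - tau) / 4 * test_mass u al 1 (2 * m.+1).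
have E0 : 0 < E by rewrite mulr_gt0// test_mass_gt0.
have decay r : 1 <= r -> R0 <= r -> r `^ (p * q - mu) * E <= K * `|K1|.
  move=> r1 rR; have r0 : 0 < r by lra.
  have := HK r _ r0 (HA r rR).
  rewrite (_ : 1 - _ - _ = (1 - tau) / 4); last by lra.
  move=> h.
  have mono : E <= (1 - tau) / 4 * test_mass u al r (2 * m.+1).
    by apply: ler_wpM2l; [exact: ltW|exact: test_mass_mono].
  have rpos : 0 < r `^ (p * q - mu) by exact: powR_gt0.
  have := ler_wpM2l (ltW rpos) (le_trans mono h).
  have -> : r `^ (p * q - mu) * (K * r `^ (- (p * q)) * (K1 * r `^ mu)) = K * K1.
    have : r `^ (p * q - mu) * r `^ (- (p * q)) * r `^ mu = 1.
      by rewrite -!powRD ?(gt_eqF r0) ?implybT// (_ : _ + _ = 0) ?powRr0//; ring.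
    by move=> e1; rewrite -[RHS]mulr1 -e1; ring.
  by move=> /le_trans; apply; rewrite ler_wpM2l ?(ltW K0)// ler_norm.
(* Chosen so that [T * E] exceeds the bound in [decay] by 1; the radius [r] below is large enough
   for [r^(p q - mu)] to reach [T]. *)
pose T := (K * `|K1| + 1) / E.
have KK0 : 0 <= K * `|K1| by rewrite mulr_ge0// ltW.
have T0 : 0 < T by rewrite divr_gt0//; lra.
pose r := Num.max (Num.max 1 R0) (T `^ (p * q - mu)^-1).
have r1 : 1 <= r by rewrite /r !le_max lexx.
have rR : R0 <= r by rewrite /r !le_max lexx orbT.
have rT : T <= r `^ (p * q - mu).
  rewrite -[leLHS](powRr1 (ltW T0)) -(mulVf (lt0r_neq0 gap)) powRrM.
  apply: ge0_ler_powR; rewrite ?nnegrE ?powR_ge0 ?(ltW gap)//; first by lra.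
  by rewrite /r le_max lexx orbT.
have := decay r r1 rR; apply/negP; rewrite -ltNge.
apply: lt_le_trans (ler_wpM2r (ltW E0) rT).
by rewrite /T divfK ?gt_eqF// ltrDl.
Qed.
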